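(* Let $\mathcal A_s=\mathbb{C}[x,y][[s]]$, $t=xy$, $h_{s,t}=1+\sum_{i\geq 1}s^it^i\in\mathcal A_s$, $E=x\partial_x+y\partial_y$ and $R=y\partial_y-x\partial_x$. Consider the complexes $$\widetilde{\mathcal P}_0^\bullet:\ 0\to\mathcal A_s\xrightarrow{d_0^1}\mathcal A_s^2\xrightarrow{d_0^2}\mathcal A_s\to 0,\qquad d_0^1(f)=(Rf,-Ef),\quad d_0^2(a,b)=Ea+Rb,$$ $$\widetilde{\mathcal P}_s^\bullet:\ 0\to\mathcal A_s\xrightarrow{d_s^1}\mathcal A_s^2\xrightarrow{d_s^2}\mathcal A_s\to 0,\qquad d_s^1(f)=(Rf,-h_{s,t}Ef),\quad d_s^2(a,b)=h_{s,t}Ea+Rb.$$ Let $\Phi^0=\operatorname{Id}_{\mathcal A_s}$, $\Phi^1(a,b)=(a,h_{s,t}b)$, $\Phi^2(c)=h_{s,t}c$. Then $\Phi^\bullet:\widetilde{\mathcal P}_0^\bullet\to\widetilde{\mathcal P}_s^\bullet$ is an isomorphism of cochain complexes. Equivalently, $\widetilde{\mathcal P}_0^\bullet\simeq\widetilde{\mathcal P}_s^\bullet$.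
   Context: The derivations $E$ and $R$ of $\mathbb{C}[x,y]$ are extended $s$-coefficientwise (i.e. $\mathbb{C}[[s]]$-linearly) to $\mathcal A_s$. The complex $\widetilde{\mathcal P}_0^\bullet$ is the logarithmic Poisson cochain complex of the normal crossing divisor $D_0=\{t=0\}$, and $\widetilde{\mathcal P}_s^\bullet$ is that of the formal deformation $D_s=\{\varphi_s=0\}$, $\varphi_s=t+\sum_{i\geq1}s^it^{i+1}=t\,h_{s,t}$. *)

(* Defs.v *)
From HB Require Import structures.
From mathcomp Require Import all_boot all_order all_algebra.
From mathcomp Require Import boolp reals complex mpoly.
From mathcomp Require Import ring.

Set Implicit Arguments.
Unset Strict Implicit.
Unset Printing Implicit Defensive.

Import GRing.Theory.
Local Open Scope ring_scope.

(* [fps V] is V[[s]]; [coefs f n] is the coefficient of s^n. A record rather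
   than an alias of [nat -> V], so that the Cauchy product does not compete
   with the pointwise structures on functions. *)
Record fps (V : Type) := FPS { coefs : nat -> V }.

Lemma fpsP (V : Type) (f g : fps V) :
  (forall n, coefs f n = coefs g n) <-> f = g.
Proof.
split=> [|-> //]; case: f g => f [g] /= fg; congr FPS; exact/funext.
Qed.

HB.instance Definition _ (V : Type) := gen_eqMixin (fps V).
HB.instance Definition _ (V : Type) := gen_choiceMixin (fps V).

Section FpsZmod.
Variable V : zmodType.
Implicit Types f g : fps V.

Definition fps0 : fps V := FPS (fun=> 0).
Definition fps_opp f : fps V := FPS (fun n => - coefs f n).
Definition fps_add f g : fps V := FPS (fun n => coefs f n + coefs g n).

Fact fps_addA : associative fps_add.
Proof. by move=> f g h; apply/fpsP => n /=; rewrite addrA. Qed.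
Fact fps_addC : commutative fps_add.
Proof. by move=> f g; apply/fpsP => n /=; rewrite addrC. Qed.
Fact fps_add0 : left_id fps0 fps_add.
Proof. by move=> f; apply/fpsP => n /=; rewrite add0r. Qed.
Fact fps_addN : left_inverse fps0 fps_opp fps_add.
Proof. by move=> f; apply/fpsP => n /=; rewrite addNr. Qed.

HB.instance Definition _ :=
  GRing.isZmodule.Build (fps V) fps_addA fps_addC fps_add0 fps_addN.

Lemma coefs0 n : coefs (0 : fps V) n = 0. Proof. by []. Qed.
Lemma coefsN f n : coefs (- f) n = - coefs f n. Proof. by []. Qed.
Lemma coefsD f g n : coefs (f + g) n = coefs f n + coefs g n.
Proof. by []. Qed.

Lemma conv_assoc (F : nat -> nat -> nat -> V) n :
  \sum_(i < n.+1) \sum_(j < i.+1) F j (i - j)%N (n - i)%N =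
  \sum_(j < n.+1) \sum_(k < (n - j).+1) F j k (n - j - k)%N.
Proof.
transitivity (\sum_(i < n.+1) \sum_(j < n.+1 | (j <= i)%N)
                F j (i - j)%N (n - i)%N).
  by apply: eq_bigr => i _; rewrite (big_ord_narrow_leq (ltn_ord i : i <= n)%N).
rewrite (exchange_big_dep xpredT) //=; apply: eq_bigr => j _.
have jn : (j <= n)%N by rewrite -ltnS ltn_ord.
rewrite -(big_mkord (fun i => j <= i)%N (fun i => F j (i - j)%N (n - i)%N)).
rewrite (big_cat_nat (n := j)) //=; last exact: leqW.
rewrite big_nat_cond big_pred0 ?add0r; last first.
  by move=> i; rewrite leq0n /=; case: ltnP.
rewrite -{1}(add0n (j : nat)) big_addn subSn //.
rewrite -(big_mkord xpredT (fun k => F j k (n - j - k)%N)).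
by apply: eq_big => [k|k _]; rewrite ?leq_addl // addnK subnDA subnAC.
Qed.

Lemma conv_rev (F : nat -> nat -> V) n :
  \sum_(i < n.+1) F i (n - i)%N = \sum_(i < n.+1) F (n - i)%N i.
Proof.
rewrite (reindex_inj rev_ord_inj) /=; apply: eq_bigr => i _.
by rewrite subSS subKn // -ltnS.
Qed.

Lemma conv_deltal (F : nat -> nat -> V) n :
  (forall i j, (0 < i)%N -> F i j = 0) ->
  \sum_(i < n.+1) F i (n - i)%N = F 0%N n.
Proof.
by move=> F0; rewrite big_ord_recl subn0 big1 ?addr0 // => i _; rewrite F0.
Qed.

End FpsZmod.

Definition fps1 (A : nzRingType) : fps A := FPS (fun n => (n == 0%N)%:R).
Definition fps_mul (A : nzRingType) (f g : fps A) : fps A :=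
  FPS (fun n => \sum_(i < n.+1) coefs f i * coefs g (n - i)%N).

Section FpsRing.
Variable A : nzRingType.
Implicit Types f g h : fps A.

Fact fps_mulA : associative (@fps_mul A).
Proof.
move=> f g h; apply/fpsP => n /=; apply: esym.
under eq_bigr do rewrite mulr_suml.
rewrite (conv_assoc (fun i j k => coefs f i * coefs g j * coefs h k)).
apply: eq_bigr => i _; rewrite mulr_sumr.
by apply: eq_bigr => j _; rewrite mulrA.
Qed.
Fact fps_mul1l : left_id (fps1 A) (@fps_mul A).
Proof.
move=> f; apply/fpsP => n /=.
rewrite (@conv_deltal _ (fun i j => (i == 0%N)%:R * coefs f j)) ?mul1r //.
by case=> // i j _; rewrite mul0r.
Qed.
Fact fps_mul1r : right_id (fps1 A) (@fps_mul A).
Proof.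
move=> f; apply/fpsP => n /=.
rewrite (conv_rev (fun i j => coefs f i * (j == 0%N)%:R)).
rewrite (@conv_deltal _ (fun i j => coefs f j * (i == 0%N)%:R)) ?mulr1 //.
by case=> // i j _; rewrite mulr0.
Qed.
Fact fps_mulDl : left_distributive (@fps_mul A) +%R.
Proof.
move=> f g h; apply/fpsP => n /=; rewrite -big_split /=.
by apply: eq_bigr => i _; rewrite mulrDl.
Qed.
Fact fps_mulDr : right_distributive (@fps_mul A) +%R.
Proof.
move=> f g h; apply/fpsP => n /=; rewrite -big_split /=.
by apply: eq_bigr => i _; rewrite mulrDr.
Qed.
Fact fps1_neq0 : fps1 A != 0.
Proof.
by apply/eqP => /fpsP/(_ 0%N) /eqP /=; rewrite oner_eq0.
Qed.

HB.instance Definition _ := GRing.Zmodule_isNzRing.Build (fps A)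
  fps_mulA fps_mul1l fps_mul1r fps_mulDl fps_mulDr fps1_neq0.

Lemma coefs1 n : coefs (1 : fps A) n = (n == 0%N)%:R. Proof. by []. Qed.
Lemma coefsM f g n :
  coefs (f * g) n = \sum_(i < n.+1) coefs f i * coefs g (n - i)%N.
Proof. by []. Qed.

End FpsRing.

Section FpsComRing.
Variable A : comNzRingType.

Fact fps_mulC : commutative (@fps_mul A).
Proof.
move=> f g; apply/fpsP => n /=.
rewrite (conv_rev (fun i j => coefs f i * coefs g j)).
by apply: eq_bigr => i _; rewrite mulrC.
Qed.

HB.instance Definition _ :=
  GRing.PzRing_hasCommutativeMul.Build (fps A) fps_mulC.

End FpsComRing.

(* V[[s]] as a K[[s]]-module, for a K-module V. *)
Definition fps_scale (K : nzRingType) (V : lmodType K)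
    (c : fps K) (f : fps V) : fps V :=
  FPS (fun n => \sum_(i < n.+1) coefs c i *: coefs f (n - i)%N).

Section FpsLmod.
Variables (K : nzRingType) (V : lmodType K).

Fact fps_scaleA (a b : fps K) (f : fps V) :
  fps_scale a (fps_scale b f) = fps_scale (a * b) f.
Proof.
apply/fpsP => n /=; apply: esym.
under eq_bigr do rewrite scaler_suml.
rewrite (conv_assoc (fun i j k => (coefs a i * coefs b j) *: coefs f k)).
apply: eq_bigr => i _; rewrite scaler_sumr.
by apply: eq_bigr => j _; rewrite scalerA.
Qed.
Fact fps_scale1 : left_id (1 : fps K) (@fps_scale K V).
Proof.
move=> f; apply/fpsP => n /=.
rewrite (@conv_deltal _ (fun i j => (i == 0%N)%:R *: coefs f j)) ?scale1r //.
by case=> // i j _; rewrite scale0r.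
Qed.
Fact fps_scaleDr : right_distributive (@fps_scale K V) +%R.
Proof.
move=> c f g; apply/fpsP => n /=; rewrite -big_split /=.
by apply: eq_bigr => i _; rewrite scalerDr.
Qed.
Fact fps_scaleDl (f : fps V) : {morph @fps_scale K V ^~ f : a b / a + b}.
Proof.
move=> a b; apply/fpsP => n /=; rewrite -big_split /=.
by apply: eq_bigr => i _; rewrite scalerDl.
Qed.

HB.instance Definition _ := GRing.Zmodule_isLmodule.Build (fps K) (fps V)
  fps_scaleA fps_scale1 fps_scaleDr fps_scaleDl.

Lemma coefsZ (c : fps K) (f : fps V) n :
  coefs (c *: f) n = \sum_(i < n.+1) coefs c i *: coefs f (n - i)%N.
Proof. by []. Qed.

End FpsLmod.

Section FpsAlg.

Fact fps_scaleAl (K : nzRingType) (A : lalgType K) (c : fps K) (f g : fps A) :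
  c *: (f * g) = (c *: f) * g.
Proof.
apply/fpsP => n /=; apply: esym.
under eq_bigr do rewrite mulr_suml.
rewrite (conv_assoc (fun i j k => (coefs c i *: coefs f j) * coefs g k)).
apply: eq_bigr => i _; rewrite scaler_sumr.
by apply: eq_bigr => j _; rewrite scalerAl.
Qed.

HB.instance Definition _ (K : nzRingType) (A : lalgType K) :=
  GRing.Lmodule_isLalgebra.Build (fps K) (fps A) (@fps_scaleAl K A).

HB.instance Definition _ (K : comNzRingType) (A : comAlgType K) :=
  GRing.Lalgebra_isComAlgebra.Build (fps K) (fps A).

End FpsAlg.

(* The s-coefficientwise extension of a map; it is K[[s]]-linear as soon as the
   map is K-linear. *)
Definition fps_map (U V : Type) (D : U -> V) (f : fps U) : fps V :=
  FPS (fun n => D (coefs f n)).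

Section FpsMap.
Variables (K : nzRingType) (U V : lmodType K) (D : {linear U -> V}).

Fact fps_map_is_linear : linear (fps_map D).
Proof.
move=> c f g; apply/fpsP => n /=; rewrite linearD linear_sum; congr (_ + _).
by apply: eq_bigr => i _; rewrite linearZ.
Qed.

HB.instance Definition _ := GRing.isLinear.Build (fps K) (fps U) (fps V) _
  (fps_map D) fps_map_is_linear.

End FpsMap.

Record cochain_complex (K : nzRingType) := CochainComplex {
  term :> nat -> lmodType K;
  diff : forall n, {linear term n -> term n.+1};
  diff_diff : forall n x, diff n.+1 (diff n x) = 0 }.

Section CochainMaps.
Variable K : nzRingType.
Implicit Types P Q : cochain_complex K.

Definition is_cochain_map P Q (phi : forall n, P n -> Q n) : Prop :=
  (forall n, linear (phi n)) /\
  (forall n x, phi n.+1 (diff P n x) = diff Q n (phi n x)).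

Definition is_cochain_iso P Q (phi : forall n, P n -> Q n) : Prop :=
  is_cochain_map phi /\
  exists psi : forall n, Q n -> P n,
    [/\ is_cochain_map psi,
        forall n, cancel (phi n) (psi n) &
        forall n, cancel (psi n) (phi n)].

Definition cochain_isomorphic P Q : Prop :=
  exists phi : forall n, P n -> Q n, is_cochain_iso phi.

End CochainMaps.

(* The complex 0 -> M0 -> M1 -> M2 -> 0, with M0 in degree 0; the zero module
   in degrees n >= 3 is 'rV[K]_0. *)
Section ThreeTerm.
Variables (K : nzRingType) (M0 M1 M2 : lmodType K).

Definition three_term_obj (n : nat) : lmodType K :=
  match n with 0 => M0 | 1 => M1 | 2 => M2 | _ => 'rV[K]_0 end.

Variables (d1 : {linear M0 -> M1}) (d2 : {linear M1 -> M2}).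

Definition three_term_diff (n : nat) :
    {linear three_term_obj n -> three_term_obj n.+1} :=
  match n with 0 => d1 | 1 => d2 | _ => \0 end.

Hypothesis d2d1 : forall x, d2 (d1 x) = 0.

Fact three_term_diff_diff n x :
  three_term_diff n.+1 (three_term_diff n x) = 0.
Proof. by case: n x => [|[|[|n]]] x //=; rewrite d2d1. Qed.

Definition three_term : cochain_complex K :=
  CochainComplex three_term_diff_diff.

End ThreeTerm.

Definition three_term_map (K : nzRingType) (M0 M1 M2 N0 N1 N2 : lmodType K)
    (f0 : M0 -> N0) (f1 : M1 -> N1) (f2 : M2 -> N2) (n : nat) :
    three_term_obj M0 M1 M2 n -> three_term_obj N0 N1 N2 n :=
  match n with 0 => f0 | 1 => f1 | 2 => f2 | _ => id end.

Section DerivationAux.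
Variable A : comNzRingType.

Lemma rderM_aux (x y p q px py qx qy : A) :
  y * (py * q + p * qy) - x * (px * q + p * qx) =
  (y * py - x * px) * q + p * (y * qy - x * qx).
Proof. by ring. Qed.

Variables (x y : A) (dx dy : A -> A).
Hypotheses (dxD : {morph dx : u v / u + v}) (dyD : {morph dy : u v / u + v}).
Hypotheses (dxN : {morph dx : u / - u}) (dyN : {morph dy : u / - u}).
Hypothesis dxM : forall p q, dx (p * q) = dx p * q + p * dx q.
Hypothesis dyM : forall p q, dy (p * q) = dy p * q + p * dy q.
Hypotheses (dxx : dx x = 1) (dyy : dy y = 1) (dxy : dx y = 0) (dyx : dy x = 0).
Hypothesis dydx : forall p, dy (dx p) = dx (dy p).

Lemma der_comm_aux p :
  x * dx (y * dy p - x * dx p) + y * dy (y * dy p - x * dx p) =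
  y * dy (x * dx p + y * dy p) - x * dx (x * dx p + y * dy p).
Proof.
rewrite !(dxD, dyD, dxN, dyN) !(dxM, dyM) dxx dyy dxy dyx dydx.
by ring.
Qed.

Lemma rder_t_aux : y * dy (x * y) - x * dx (x * y) = 0.
Proof. by rewrite dxM dyM dxx dyy dxy dyx; ring. Qed.

End DerivationAux.

(* C is R[i], C[x,y] is {mpoly C[2]} with x, y the variables of index 0, 1. *)
Section LogPoissonComplexes.
Variable R : realType.

Definition Cxy : comAlgType R[i]%C := {mpoly R[i]%C[2]}.

Definition varX : Cxy := 'X_(ord0 : 'I_2).
Definition varY : Cxy := 'X_(ord_max : 'I_2).
Definition dX (p : Cxy) : Cxy := mderiv (ord0 : 'I_2) p.
Definition dY (p : Cxy) : Cxy := mderiv (ord_max : 'I_2) p.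

Definition Ederiv (p : Cxy) : Cxy := varX * dX p + varY * dY p.
Definition Rderiv (p : Cxy) : Cxy := varY * dY p - varX * dX p.

Fact Ederiv_is_linear : linear Ederiv.
Proof.
move=> a p q; rewrite /Ederiv /dX /dY !linearP /= !mulrDr -!scalerAr scalerDr.
by rewrite addrACA.
Qed.
Fact Rderiv_is_linear : linear Rderiv.
Proof.
move=> a p q; rewrite /Rderiv /dX /dY !linearP /= !mulrDr -!scalerAr scalerBr.
by rewrite opprD addrACA.
Qed.
HB.instance Definition _ :=
  GRing.isLinear.Build R[i]%C Cxy Cxy _ Ederiv Ederiv_is_linear.
HB.instance Definition _ :=
  GRing.isLinear.Build R[i]%C Cxy Cxy _ Rderiv Rderiv_is_linear.

Definition Cs : comNzRingType := fps R[i]%C.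
Definition As : comAlgType Cs := fps Cxy.

Definition Es : {linear As -> As} := fps_map Ederiv.
Definition Rs : {linear As -> As} := fps_map Rderiv.

(* 1 + sum_(i >= 1) s^i t^i with t = xy; its constant term is t^0 = 1. *)
Definition h : As := FPS (fun i => (varX * varY) ^+ i).

Definition d0_1 (f : As) : (As * As)%type := (Rs f, - Es f).
Definition d0_2 (u : As * As) : As := Es u.1 + Rs u.2.
Definition ds_1 (f : As) : (As * As)%type := (Rs f, - (h * Es f)).
Definition ds_2 (u : As * As) : As := h * Es u.1 + Rs u.2.

Fact d0_1_is_linear : linear d0_1.
Proof.
by move=> a f g; congr (_, _); rewrite linearP //= opprD scalerN.
Qed.
Fact d0_2_is_linear : linear d0_2.
Proof.
by move=> a u v; rewrite /d0_2 /= !linearP /= scalerDr addrACA.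
Qed.
Fact ds_1_is_linear : linear ds_1.
Proof.
move=> a f g; congr (_, _); first by rewrite linearP.
by rewrite linearP /= mulrDr -scalerAr opprD scalerN.
Qed.
Fact ds_2_is_linear : linear ds_2.
Proof.
move=> a u v; rewrite /ds_2 /= !linearP /= mulrDr -scalerAr scalerDr.
by rewrite addrACA.
Qed.
HB.instance Definition _ :=
  GRing.isLinear.Build Cs As (As * As)%type _ d0_1 d0_1_is_linear.
HB.instance Definition _ :=
  GRing.isLinear.Build Cs (As * As)%type As _ d0_2 d0_2_is_linear.
HB.instance Definition _ :=
  GRing.isLinear.Build Cs As (As * As)%type _ ds_1 ds_1_is_linear.
HB.instance Definition _ :=
  GRing.isLinear.Build Cs (As * As)%type As _ ds_2 ds_2_is_linear.

Let subUU i : (U_(i) - U_(i))%MM = 0%MM :> 'X_{1..2}.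
Proof. by rewrite -[X in (X - _)%MM]add0m addmK. Qed.

Lemma dX_X : dX varX = 1.
Proof. by rewrite /dX /varX mderivX mnm1E eqxx scale1r subUU mpolyX0. Qed.
Lemma dY_Y : dY varY = 1.
Proof. by rewrite /dY /varY mderivX mnm1E eqxx scale1r subUU mpolyX0. Qed.
Lemma dX_Y : dX varY = 0.
Proof. by rewrite /dX /varY mderivX mnm1E scale0r. Qed.
Lemma dY_X : dY varX = 0.
Proof. by rewrite /dY /varX mderivX mnm1E scale0r. Qed.
Lemma dXM p q : dX (p * q) = dX p * q + p * dX q.
Proof. exact: mderivM. Qed.
Lemma dYM p q : dY (p * q) = dY p * q + p * dY q.
Proof. exact: mderivM. Qed.
Lemma dYX p : dY (dX p) = dX (dY p).
Proof. exact: mderiv_comm. Qed.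

Lemma RderivM p q : Rderiv (p * q) = Rderiv p * q + p * Rderiv q.
Proof. by rewrite /Rderiv dXM dYM rderM_aux. Qed.

Lemma ER_comm p : Ederiv (Rderiv p) = Rderiv (Ederiv p).
Proof.
apply: (der_comm_aux (raddfD (mderiv _)) (raddfD (mderiv _)) (raddfN _)
  (raddfN _) dXM dYM dX_X dY_Y dX_Y dY_X dYX p).
Qed.

Lemma Rderiv_t n : Rderiv ((varX * varY) ^+ n) = 0.
Proof.
elim: n => [|n IHn]; last first.
  rewrite exprS RderivM IHn mulr0 addr0 /Rderiv.
  rewrite (rder_t_aux dXM dYM dX_X dY_Y dX_Y dY_X).
  by rewrite mul0r.
have := RderivM 1 1; rewrite expr0 !mulr1 mul1r => /eqP.
by rewrite -subr_eq0 opprD addNKr oppr_eq0 => /eqP.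
Qed.

Lemma Rs_hM (g : As) : Rs (h * g) = h * Rs g.
Proof.
apply/fpsP => n /=; rewrite linear_sum; apply: eq_bigr => i _ /=.
by rewrite RderivM Rderiv_t mul0r add0r.
Qed.

Fact d0_2_d0_1 f : d0_2 (d0_1 f) = 0.
Proof.
rewrite /d0_2 /d0_1 /= linearN /=; apply/fpsP => n /=.
by rewrite ER_comm subrr.
Qed.

Fact ds_2_ds_1 f : ds_2 (ds_1 f) = 0.
Proof.
rewrite /ds_2 /ds_1 /= linearN /= Rs_hM -mulrBr.
have -> : Es (Rs f) = Rs (Es f) by apply/fpsP => n /=; rewrite ER_comm.
by rewrite subrr mulr0.
Qed.

Definition P0 : cochain_complex Cs := three_term d0_2_d0_1.
Definition Ps : cochain_complex Cs := three_term ds_2_ds_1.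

Definition Phi0 (f : As) : As := f.
Definition Phi1 (u : As * As) : (As * As)%type := (u.1, h * u.2).
Definition Phi2 (c : As) : As := h * c.

Definition Phi : forall n, P0 n -> Ps n := three_term_map Phi0 Phi1 Phi2.

End LogPoissonComplexes.

(* Main.v *)
Require Import Defs.
From mathcomp Require Import all_boot all_order all_algebra.
From mathcomp Require Import reals.

(** The map [Phi] commutes with the differentials because [R t = 0], so [Rs]
    commutes with multiplication by [h]. Since [h] is the geometric series in
    [s t], it is a unit of [As] with inverse [1 - s t], and dividing by [h]
    inverts [Phi]. *)

Import GRing.Theory.
Local Open Scope ring_scope.

(** Each [phi n] is injective, so linearity of [psi] and its compatibility with the differentials
    can be checked after applying [phi]. *)
Lemma cochain_iso_of_cancel (K : nzRingType) (P Q : cochain_complex K)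
    (phi : forall n, P n -> Q n) (psi : forall n, Q n -> P n) :
  is_cochain_map phi ->
  (forall n, cancel (phi n) (psi n)) -> (forall n, cancel (psi n) (phi n)) ->
  is_cochain_iso phi.
Proof.
move=> [phi_lin phi_d] phiK psiK; split=> //; exists psi; split=> //; split.
  move=> n c u v; apply: (can_inj (phiK n)).
  by rewrite phi_lin !psiK.
move=> n u; apply: (can_inj (phiK n.+1)).
by rewrite phi_d !psiK.
Qed.

Definition one_sub_st (A : nzRingType) (t : A) : fps A :=
  FPS (fun n => match n with 0 => 1 | 1 => - t | _ => 0 end).

(** The product telescopes: in degree $n+1$ only the first two coefficients of [one_sub_st]
    contribute, giving $t^{n+1} - t\,t^n = 0$. *)
Lemma one_sub_st_mul_geometric (A : nzRingType) (t : A) :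
  one_sub_st A t * FPS (fun n => t ^+ n) = 1.
Proof.
apply/fpsP => -[|n]; rewrite coefsM coefs1 big_ord_recl /= mul1r subn0.
  by rewrite big_ord0 addr0.
rewrite big_ord_recl big1 => [|i _]; last by rewrite /= mul0r.
by rewrite /= subSS subn0 addr0 exprS mulNr subrr.
Qed.

Lemma h_inverse (R : realType) :
  one_sub_st (Cxy R) (varX R * varY R) * h R = 1.
Proof. exact: one_sub_st_mul_geometric. Qed.

Lemma Phi_is_cochain_map (R : realType) : is_cochain_map (@Phi R).
Proof.
(* What survives is linearity in degrees 1 and 2, then the squares out of degrees 0 and 1. *)
split=> [[|[|[|n]]] //|[|[|[|n]]] //].
- move=> c u v; congr (_, _).
  by rewrite /= mulrDr -scalerAr.
- by move=> c u v; rewrite /= /Phi2 mulrDr -scalerAr.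
- by move=> f; congr (_, _); rewrite /= mulrN.
- by move=> u; rewrite /= /Phi2 /d0_2 /ds_2 /= Rs_hM mulrDr.
Qed.

Lemma Phi_is_cochain_iso (R : realType) : is_cochain_iso (@Phi R).
Proof.
pose g : As R := one_sub_st (Cxy R) (varX R * varY R).
have gh : g * h R = 1 by exact: h_inverse.
have mulhK (a : As R) : g * (h R * a) = a by rewrite mulrA gh mul1r.
(* Commutativity of [As] makes the left inverse [g] two-sided. *)
have mulgK (a : As R) : h R * (g * a) = a by rewrite mulrCA mulhK.
pose Psi1 (u : As R * As R) : (As R * As R)%type := (u.1, g * u.2).
pose Psi2 (c : As R) : As R := g * c.
have Phi1K : cancel (@Phi1 R) Psi1 by case=> a b; congr (_, _); exact: mulhK.
have Psi1K : cancel Psi1 (@Phi1 R) by case=> a b; congr (_, _); exact: mulgK.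
have Phi2K : cancel (@Phi2 R) Psi2 by move=> c; exact: mulhK.
have Psi2K : cancel Psi2 (@Phi2 R) by move=> c; exact: mulgK.
pose psi n : Ps R n -> P0 R n := three_term_map (@id (As R)) Psi1 Psi2 (n := n).
apply: (@cochain_iso_of_cancel _ (P0 R) (Ps R) (@Phi R) psi).
- exact: Phi_is_cochain_map.
(* In degree 0 and in degrees at least 3 both maps are the identity. *)
- exact (fun n => match n with
    | 0 => fun=> erefl | 1 => Phi1K | 2 => Phi2K | _ => fun=> erefl end).
- exact (fun n => match n with
    | 0 => fun=> erefl | 1 => Psi1K | 2 => Psi2K | _ => fun=> erefl end).
Qed.

Theorem proposition5p26 (R : realType) :
  is_cochain_iso (@Phi R) /\ cochain_isomorphic (P0 R) (Ps R).
Proof.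
split; first exact: Phi_is_cochain_iso.
by exists (@Phi R); exact: Phi_is_cochain_iso.
Qed.
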